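(* For every finite generic set $X\subset\mathbb{R}^2$, $$\mathrm{span}_2(X)-\mathrm{span}_4(X)+\mathrm{exposed}(X)=3(|X|-1),$$ $$2\,\mathrm{span}_2(X)-\mathrm{span}_3(X)+\mathrm{exposed}(X)=4(|X|-1).$$
   Context: A rectangle is a closed axis-aligned rectangle in $\mathbb{R}^2$. A finite set $X\subset\mathbb{R}^2$ is generic if no two points of $X$ share a coordinate. For $A\subseteq X$, $R[A]=\{s\in\mathbb{R}^2: \min_{x\in A}x_i\le s_i\le \max_{x\in A}x_i,\ i=1,2\}$ is the rectangle spanned by $A$. For $k\ge 2$, $\mathrm{span}_k(X)$ is the number of $k$-element subsets $A\subseteq X$ such that the open interior of $R[A]$ contains no point of $X$ and all elements of $A$ lie on the boundary of $R[A]$. A point $p\in X$ is orthogonally exposed if at least one of the four open quadrants $\{s: s_1>p_1,s_2>p_2\}$, $\{s: s_1<p_1,s_2>p_2\}$, $\{s: s_1<p_1,s_2<p_2\}$, $\{s: s_1>p_1,s_2<p_2\}$ contains no point of $X$; $\mathrm{exposed}(X)$ is the number of orthogonally exposed points of $X$.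
   Formalization: The theorem assumes |X| ≥ 2 and adds to exposed(X) the number of points of X whose empty quadrants are exactly one opposite pair. As printed, both identities fail for |X| ≤ 1 and for {(0,0),(1,1),(2,2)}, where the first reads 5 = 6. *)

(* Defs.v *)
From mathcomp Require Import all_boot all_order all_algebra finmap.
From mathcomp Require Import boolp classical_sets reals topology normedtype.
Set Implicit Arguments.
Unset Strict Implicit.
Unset Printing Implicit Defensive.
Import Order.TTheory GRing.Theory Num.Theory numFieldNormedType.Exports.
Local Open Scope fset_scope.
Local Open Scope classical_set_scope.
Local Open Scope ring_scope.

Section Plane.
Variable R : realType.
Implicit Types (X A : {fset R * R}) (p q s : R * R).

Definition generic X :=
  forall p q, p \in X -> q \in X -> p != q -> p.1 != q.1 /\ p.2 != q.2.

(* The default value [f (head 0 A)] is itself a value of [f] on [A] as soon as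
   [A] is nonempty, so these are then the minimum and the maximum of [f] on
   [A]. *)
Definition fmin (f : R * R -> R) A : R :=
  \big[Num.min/f (head 0 (enum_fset A))]_(p <- enum_fset A) f p.

Definition fmax (f : R * R -> R) A : R :=
  \big[Num.max/f (head 0 (enum_fset A))]_(p <- enum_fset A) f p.

Definition rectangle A : set (R * R) :=
  [set s | fmin fst A <= s.1 <= fmax fst A /\ fmin snd A <= s.2 <= fmax snd A].

Definition boundary (S : set (R * R)) : set (R * R) := closure S `\` interior S.

Definition spanning X A : Prop :=
  (forall x, x \in X -> ~ interior (rectangle A) x) /\
  (forall a, a \in A -> boundary (rectangle A) a).

Definition span_num (k : nat) X : nat :=
  #|` [fset A in fpowerset X | (#|` A| == k) && `[< spanning X A >]]|.

Definition quadrantNE p : set (R * R) := [set s | p.1 < s.1 /\ p.2 < s.2].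
Definition quadrantNW p : set (R * R) := [set s | s.1 < p.1 /\ p.2 < s.2].
Definition quadrantSW p : set (R * R) := [set s | s.1 < p.1 /\ s.2 < p.2].
Definition quadrantSE p : set (R * R) := [set s | p.1 < s.1 /\ s.2 < p.2].

Definition avoids X (Q : set (R * R)) : Prop := forall x, x \in X -> ~ Q x.

Definition orthogonally_exposed X p : Prop :=
  [\/ avoids X (quadrantNE p), avoids X (quadrantNW p),
      avoids X (quadrantSW p) | avoids X (quadrantSE p)].

Definition exposed X : nat :=
  #|` [fset p in X | `[< orthogonally_exposed X p >]]|.

(* [p] is exposed from two opposite sides that are separated by points of [X]:
   the empty quadrants at [p] are exactly NE and SW, or exactly NW and SE.
   Already for the increasing chain (0,0), (1,1), (2,2), the identity
   span_2 - span_4 + exposed = 3 (|X| - 1) reads 2 - 0 + 3 = 6; it becomes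
   correct once such points (here the middle one) are counted twice among the
   exposed points. *)
Definition pinched X p : Prop :=
  (avoids X (quadrantNE p) /\ avoids X (quadrantSW p) /\
   ~ avoids X (quadrantNW p) /\ ~ avoids X (quadrantSE p)) \/
  (avoids X (quadrantNW p) /\ avoids X (quadrantSE p) /\
   ~ avoids X (quadrantNE p) /\ ~ avoids X (quadrantSW p)).

Definition npinched X : nat := #|` [fset p in X | `[< pinched X p >]]|.

End Plane.

(* Main.v *)
(* Call a pair (s, p) with s below p empty if the open rectangle spanned by it
   contains no point. Every spanning set A with at least two points is the empty
   pair of its lowest and highest points, together with at most one further point
   on each side: the nearest point to the west (east) of the pair in the
   horizontal strip between them. Hence, if l (r) is the indicator that the strip
   contains a point west (east) of the empty pair, then span_2, span_3, span_4
   are the sums over the empty pairs of 1, l + r, l r, respectively.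

   An empty pair with l = 0 is either made of a point o and the lowest point of
   its NW quadrant, or of o and the highest point of its SW quadrant, so that the
   sum of 1 - l is the number of nonempty NW and SW quadrants; likewise for
   1 - r. The pairs with l = r = 0 are those with consecutive heights, and there
   are |X| - 1 of them. Finally exposed + pinched is the number of empty
   quadrants minus 4. *)
Require Import Defs.
From mathcomp Require Import all_boot all_order all_algebra finmap.
From mathcomp Require Import boolp classical_sets reals topology normedtype.
From mathcomp Require Import lra zify.
Import Order.TTheory GRing.Theory Num.Theory numFieldNormedType.Exports.
Local Open Scope fset_scope.
Local Open Scope ring_scope.

Section Counting.
Context {R : realFieldType} {T : finType}.
Implicit Types (f x y : T -> R) (e : T * T) (B : {set T}).

(** * Extremal elements in finite types *)

Lemma inj_lt_total f a b : injective f -> a != b -> f a < f b \/ f b < f a.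
Proof. by move=> f_inj neq_ab; apply/orP; rewrite -neq_lt (inj_eq f_inj). Qed.

Lemma ex_argmin f (P : pred T) t0 :
  P t0 -> exists2 m, P m & forall z, P z -> f m <= f z.
Proof. by move=> Pt0; case: (@arg_minP _ _ T t0 P f Pt0) => m; exists m. Qed.

Lemma ex_argmax f (P : pred T) t0 :
  P t0 -> exists2 m, P m & forall z, P z -> f z <= f m.
Proof. by move=> Pt0; case: (@arg_maxP _ _ T t0 P f Pt0) => m; exists m. Qed.

Lemma card_max f (t0 : T) :
  injective f -> #|[set p | [forall z, f z <= f p]]| = 1%N.
Proof.
move=> f_inj.
have [m _ m_max] := ex_argmax f xpredT t0 isT.
apply: (@eq_card1 _ m) => p; rewrite !inE.
apply/forallP/eqP => [p_max|-> z]; last exact: m_max.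
by apply: f_inj; apply/eqP; rewrite eq_le p_max m_max.
Qed.

(** By injectivity of [f], the first projection maps these pairs bijectively onto the [s] for which
    [N s] is inhabited. This is how nonempty quadrants become pairs of points. *)
Lemma card_argmin (S : finType) f (N : S -> pred T) : injective f ->
  #|[set e : S * T | N e.1 e.2 && [forall z, N e.1 z ==> (f e.2 <= f z)]]|
    = #|[set s | [exists z, N s z]]|.
Proof.
move=> f_inj; rewrite -(@card_in_imset _ _ fst); last first.
  move=> [s p] [s' p']; rewrite !inE /= => /andP[Np /forallP p_min].
  move=> /andP[Np' /forallP p'_min] ss'; subst s'; congr (_, _); apply: f_inj.
  by apply/eqP; rewrite eq_le (implyP (p_min _) Np') (implyP (p'_min _) Np).
apply: eq_card => s; rewrite !inE; apply/imsetP/existsP.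
  by case=> [[s' p]]; rewrite inE /= => /andP[Np _] ->; exists p.
case=> z Nz; have [m Nm m_min] := ex_argmin f (N s) z Nz.
exists (s, m) => //; rewrite inE /= Nm /=.
by apply/forallP => t; apply/implyP => /m_min.
Qed.

(** * Empty pairs and their extensions to the west and east *)

Definition strip y e z := y e.1 < y z < y e.2.

(** Putting the lower point first makes each unordered pair count once; the disjunction covers both
    slopes. *)
Definition empty_pair x y e :=
  (y e.1 < y e.2) &&
  [forall z, strip y e z ==>
     ~~ ((x e.1 < x z < x e.2) || (x e.2 < x z < x e.1))].

(* West is the default direction of [beside], [nearest], [extends] and, with
   north, of [quad]; the other ones are obtained by replacing [x] with [\- x]
   and [y] with [\- y]. *)
Definition beside x y e z := [&& strip y e z, x z < x e.1 & x z < x e.2].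

Definition nearest x y e z :=
  beside x y e z && [forall t, beside x y e t ==> (x t <= x z)].

Definition extends x y e := [exists z, beside x y e z].

Definition quad x y p z := (x z < x p) && (y p < y z).

Definition inhab x y p := [exists z, quad x y p z].

(** The four conditions place [z] in the open bounding box of [B]. As [z] also ranges over [B], the
    elements of [B] are forced onto the boundary. *)
Definition spans x y B :=
  [forall z, ~~ [&& [exists a in B, x a < x z], [exists a in B, x z < x a],
                    [exists a in B, y a < y z] & [exists a in B, y z < y a]]].

Lemma empty_pairN x y e : empty_pair (\- x) y e = empty_pair x y e.
Proof.
rewrite /empty_pair; congr (_ && _); apply: eq_forallb => z.
by rewrite /= !ltrN2 orbC [X in X || _]andbC [X in _ || X]andbC.
Qed.

(* Let [o] be the eastern point of such a pair. If [o] is the bottom point, the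
   other one is the lowest point of the NW quadrant of [o]; if [o] is the top
   point, the other one is the highest point of its SW quadrant. *)
Lemma card_empty_unextended x y : injective x -> injective y ->
  #|[set e | empty_pair x y e && ~~ extends x y e]| =
  (#|[set p | inhab x y p]| + #|[set p | inhab x (\- y) p]|)%N.
Proof.
move=> x_inj y_inj.
have Ny_inj : injective (\- y) by move=> a b /= /oppr_inj /y_inj.
rewrite -[X in (X + _)%N](@card_argmin _ y (quad x y)) //.
rewrite -[X in (_ + X)%N](@card_argmin _ (\- y) (quad x (\- y))) //.
(* In the SW family the first component is the top point; swapping puts the lower point first. *)
rewrite -[X in (_ + X)%N](@card_imset _ _ (fun e => (e.2, e.1))); last first.
  by move=> [a b] [c d] [-> ->].
(* The families are disjoint: the eastern point is the bottom one in the first and the top one in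
   the second. *)
rewrite -cardsUI [X in _ = (_ + X)%N](_ : _ = 0%N) ?addn0; last first.
  apply/eqP; rewrite cards_eq0; apply/eqP/finset.setP => -[s p]; rewrite !inE.
  apply/negP => /andP[/andP[/andP[/= h1 _] _] /imsetP[[s' p']]].
  rewrite inE => /andP[/andP[/= h2 _] _] [ss' pp']; subst s' p'.
  by lra.
apply: eq_card => -[s p]; rewrite !inE.
apply/idP/idP.
- case/andP=> /andP[/= ysp /forallP emp] /existsPn ext.
  (* Emptiness excludes positions between the two points, and the missing extension those west of
     both. *)
  have h z : strip y (s, p) z -> (x s <= x z) && (x p <= x z).
    move=> hz; have := ext z; rewrite /beside hz /=.
    have:= emp z; rewrite hz /=.
    have zs : z != s by apply/negP => /eqP zE; move: hz; rewrite zE /strip ltxx.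
    have zp : z != p.
      by apply/negP => /eqP zE; move: hz; rewrite zE /strip ltxx andbF.
    case: (inj_lt_total _ _ _ x_inj zs); case: (inj_lt_total _ _ _ x_inj zp);
      move=> H1 H2; rewrite ?H1 ?H2 //= ?orbT //; move=> _ _; lra.
  have sp : s != p by apply/negP => /eqP sp; move: ysp; rewrite sp ltxx.
  apply/orP; case: (inj_lt_total _ _ _ x_inj sp) => xsp.
  + right; apply/imsetP; exists (p, s) => //; rewrite inE /quad /= xsp ltrN2 ysp.
    apply/forallP => z; apply/implyP => /andP[xz]; rewrite ltrN2 => yz.
    rewrite lerN2 leNgt; apply/negP => yz'.
    by have := h z; rewrite /strip /= yz yz' => /(_ isT); lra.
  + left; rewrite /quad /= xsp ysp.
    apply/forallP => z; apply/implyP => /andP[xz] yz.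
    rewrite leNgt; apply/negP => yz'.
    by have := h z; rewrite /strip /= yz yz' => /(_ isT); lra.
- case/orP => [/andP[/andP[/= xsp ysp] /forallP h]|/imsetP[[p' s']]].
  + rewrite /empty_pair /= ysp /=; apply/andP; split.
      apply/forallP => z; apply/implyP => /andP[/= z1 z2].
      by have := h z; rewrite /quad /= z1; case: ltP => //= *; lra.
    apply/existsPn => z; apply/negP => /and3P[/andP[/= z1 z2] z3 z4].
    by have := h z; rewrite /quad /= z1 z3 /=; lra.
  + rewrite inE /= => /andP[/andP[/= xsp ysp] /forallP h] [? ?]; subst s' p'.
    rewrite ltrN2 in ysp.
    rewrite /empty_pair /= ysp /=; apply/andP; split.
      apply/forallP => z; apply/implyP => /andP[/= z1 z2].
      by have := h z; rewrite /quad /= ltrN2 z2; case: ltP => //= *; lra.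
    apply/existsPn => z; apply/negP => /and3P[/andP[/= z1 z2] z3 z4].
    by have := h z; rewrite /quad /= ltrN2 z2 z4 /=; lra.
Qed.

(* These are the pairs of points that are consecutive in the order of [y]. *)
Lemma card_empty_consecutive x y : injective x -> injective y ->
  #|[set e | [&& empty_pair x y e, ~~ extends x y e & ~~ extends (\- x) y e]]|
    = #|T|.-1.
Proof.
move=> x_inj y_inj.
(* All points but the highest have a higher point, and then a unique successor; for empty [T] both
   sides are 0. *)
have -> : #|T|.-1 = #|[set s | [exists z, y s < y z]]|.
  case: (pickP (@predT T)) => [t0 _|T0]; last first.
    rewrite (eq_card0 T0); apply/esym/eqP; rewrite cards_eq0.
    by apply/eqP/finset.setP => z; have := T0 z.
  rewrite -(cardsC [set s | [exists z, y s < y z]]).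
  rewrite [X in (_ + X)%N](_ : _ = 1%N) ?addn1 //.
  rewrite -(card_max y t0 y_inj); apply: eq_card => p; rewrite !inE.
  by rewrite negb_exists; apply: eq_forallb => z; rewrite leNgt.
rewrite -(@card_argmin _ y (fun s z => y s < y z)) //.
apply: eq_card => -[s p]; rewrite !inE /=; apply/idP/idP.
(* A point at an intermediate height would lie between the two points, west of both or east of both;
   each hypothesis excludes one position. *)
- case/and3P=> /andP[/= ysp /forallP emp] /existsPn extl /existsPn extr.
  rewrite ysp; apply/forallP => z; apply/implyP => yz; rewrite leNgt.
  apply/negP => yz'.
  have := emp z; have := extl z; have := extr z.
  have zs : z != s by apply/negP => /eqP zE; move: yz; rewrite zE ltxx.
  have zp : z != p by apply/negP => /eqP zE; move: yz'; rewrite zE ltxx.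
  rewrite /beside /strip /= yz yz' /= !ltrN2.
  by case: (inj_lt_total _ _ _ x_inj zs) => ->;
     case: (inj_lt_total _ _ _ x_inj zp) => ->; rewrite ?orbT.
- case/andP=> ysp /forallP h.
  have no z : strip y (s, p) z = false.
    by apply/negP => /andP[/= z1 z2]; have := h z; rewrite z1 /=; lra.
  rewrite /empty_pair /= ysp /=; apply/and3P; split.
  + by apply/forallP => z; rewrite no.
  + by apply/existsPn => z; rewrite /beside no.
  + by apply/existsPn => z; rewrite /beside no.
Qed.

(** * Spanning sets as hulls of empty pairs *)

Lemma beside_neq x y e z : beside x y e z -> z != e.1 /\ z != e.2.
Proof.
case/and3P => _ z1 z2; split; apply/negP => /eqP zE.
  by move: z1; rewrite zE ltxx.
by move: z2; rewrite zE ltxx.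
Qed.

Lemma nearest_set x y e : injective x -> extends x y e ->
  exists2 q, beside x y e q & [set z | nearest x y e z] = [set q].
Proof.
move=> x_inj /existsP[z0 z0P].
have [q q_beside q_max] := ex_argmax x (beside x y e) z0 z0P.
exists q => //; apply/finset.setP => z; rewrite !inE.
apply/andP/eqP => [[z_b /forallP z_max]|->].
  apply: x_inj; apply/eqP; rewrite eq_le q_max //.
  by have /implyP -> := z_max q.
by split=> //; apply/forallP => t; apply/implyP => /q_max.
Qed.

(** The flags choose whether the nearest western and eastern points are adjoined; a flag has no
    effect on a side without such a point. *)
Definition hull x y (bl br : bool) e : {set T} :=
  [set e.1; e.2] :|: [set z | bl && nearest x y e z]
    :|: [set z | br && nearest (\- x) y e z].

Lemma mem_hull x y bl br e z : z \in hull x y bl br e =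
  [|| z == e.1, z == e.2, bl && nearest x y e z | br && nearest (\- x) y e z].
Proof. by rewrite !inE -!orbA. Qed.

Lemma hull_y x y bl br e z : y e.1 < y e.2 -> z \in hull x y bl br e ->
  y e.1 <= y z <= y e.2.
Proof.
move=> ye; rewrite mem_hull.
case/or4P => [/eqP->|/eqP->|/andP[_ /andP[/andP[/andP[z1 z2] _] _]]|
              /andP[_ /andP[/andP[/andP[z1 z2] _] _]]]; lra.
Qed.

(** Adjoined points lie in the strip, so [e] is recovered as the lowest and highest points of its
    hull, whatever the flags. *)
Lemma hull_inj x y bl br bl' br' e e' : injective y ->
  empty_pair x y e -> empty_pair x y e' ->
  hull x y bl br e = hull x y bl' br' e' -> e = e'.
Proof.
move=> y_inj /andP[ye _] /andP[ye' _] eqH.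
have m1 : e.1 \in hull x y bl br e by rewrite mem_hull eqxx.
have m2 : e.2 \in hull x y bl br e by rewrite mem_hull eqxx orbT.
have m1' : e'.1 \in hull x y bl' br' e' by rewrite mem_hull eqxx.
have m2' : e'.2 \in hull x y bl' br' e' by rewrite mem_hull eqxx orbT.
rewrite eqH in m1 m2; rewrite -eqH in m1' m2'.
have := (hull_y _ _ _ _ _ _ ye' m1, hull_y _ _ _ _ _ _ ye' m2,
         hull_y _ _ _ _ _ _ ye m1', hull_y _ _ _ _ _ _ ye m2').
case: e e' {eqH m1 m2 m1' m2'} ye ye' => [s p] [s' p'] /= _ _ [[[h1 h2] h3] h4].
by congr (_, _); apply: y_inj; apply/eqP; rewrite eq_le; lra.
Qed.

Lemma card_hull x y (bl br : bool) e : injective x -> injective y ->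
  empty_pair x y e -> (bl ==> extends x y e) -> (br ==> extends (\- x) y e) ->
  #|hull x y bl br e| = (2 + bl + br)%N.
Proof.
move=> x_inj y_inj /andP[ye _] hl hr.
have Nx_inj : injective (\- x) by move=> a b /= /oppr_inj /x_inj.
have e12 : e.1 != e.2 by apply/negP => /eqP e12; move: ye; rewrite e12 ltxx.
have set0F : [set z : T | false] = finset.set0 by apply/finset.setP => z; rewrite !inE.
rewrite /hull; case: bl hl => hl; case: br hr => hr /=; rewrite ?set0F.
- have [q qb ->] := nearest_set _ _ _ x_inj hl.
  have [r rb ->] := nearest_set _ _ _ Nx_inj hr.
  have [q1 q2] := beside_neq _ _ _ _ qb; have [r1 r2] := beside_neq _ _ _ _ rb.
  have rq : r != q.
    apply/negP => /eqP rq; move: rb qb; rewrite rq.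
    by move=> /and3P[_ /= h1 _] /and3P[_ h2 _]; lra.
  rewrite finset.setUC cardsU1 finset.setUC cardsU1 cards2 !inE.
  by rewrite (negPf rq) (negPf r1) (negPf r2) (negPf q1) (negPf q2) e12.
- have [q qb ->] := nearest_set _ _ _ x_inj hl.
  have [q1 q2] := beside_neq _ _ _ _ qb.
  by rewrite finset.setU0 finset.setUC cardsU1 cards2 !inE (negPf q1) (negPf q2) e12.
- have [r rb ->] := nearest_set _ _ _ Nx_inj hr.
  have [r1 r2] := beside_neq _ _ _ _ rb.
  by rewrite finset.setU0 finset.setUC cardsU1 cards2 !inE (negPf r1) (negPf r2) e12.
- by rewrite !finset.setU0 cards2 e12.
Qed.

(** A point inside the bounding box lies in the strip, hence by emptiness west or east of both
    points of [e]. It would then be nearer to them than the adjoined point on that side. *)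
Lemma spans_hull x y bl br e : injective x ->
  empty_pair x y e -> spans x y (hull x y bl br e).
Proof.
move=> x_inj /andP[ye /forallP emp]; apply/forallP => z; apply/negP.
case/and4P=> /exists_inP[a ae az] /exists_inP[b be zb].
move=> /exists_inP[c /(hull_y _ _ _ _ _ _ ye) ce cz].
move=> /exists_inP[d /(hull_y _ _ _ _ _ _ ye) de zd].
have zs : strip y e z by rewrite /strip; lra.
have z1 : z != e.1 by apply/negP => /eqP zE; move: zs; rewrite /strip zE; lra.
have z2 : z != e.2 by apply/negP => /eqP zE; move: zs; rewrite /strip zE; lra.
have := emp z; rewrite zs /=.
case: (inj_lt_total _ _ _ x_inj z1) => h1;
  case: (inj_lt_total _ _ _ x_inj z2) => h2; rewrite ?h1 ?h2 ?orbT // => _.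
- move: ae; rewrite mem_hull => /or4P[/eqP aE|/eqP aE||].
  + by rewrite aE in az; lra.
  + by rewrite aE in az; lra.
  + case/andP=> _ /andP[_ /forallP /(_ z)]; rewrite /beside zs h1 h2 /=; lra.
  + case/andP=> _ /andP[/and3P[_ /=] + + _]; lra.
- move: be; rewrite mem_hull => /or4P[/eqP aE|/eqP aE||].
  + by rewrite aE in zb; lra.
  + by rewrite aE in zb; lra.
  + case/andP=> _ /andP[/and3P[_ /=] + + _]; lra.
  + case/andP=> _ /andP[_ /forallP /(_ z)]; rewrite /beside zs /= !ltrN2 h1 h2 /=.
    lra.
Qed.

(** Here [e] consists of the lowest and highest points of [B], and the flags record whether [B] has
    a point on each side. *)
Lemma spans_hullP x y B : injective x -> injective y ->
  (1 < #|B|)%N -> spans x y B ->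
  exists e (bl br : bool), [/\ empty_pair x y e, bl ==> extends x y e,
    br ==> extends (\- x) y e & B = hull x y bl br e].
Proof.
move=> x_inj y_inj /card_gt1P[b1 [b2 [b1B b2B b12]]] /forallP spB.
have [s sB s_min] := ex_argmin y (mem B) b1 b1B.
have [p pB p_max] := ex_argmax y (mem B) b1 b1B.
have ysp : y s < y p.
  have := s_min _ b1B; have := s_min _ b2B; have := p_max _ b1B.
  by have := p_max _ b2B; case: (inj_lt_total _ _ _ y_inj b12); lra.
pose e := (s, p).
(* Such a [z] in the strip would be interior to the bounding box, with [s] and [p] as vertical
   bounds. *)
have inside z a b : a \in B -> b \in B -> x a < x z -> x z < x b ->
    ~~ strip y e z.
  move=> aB bB az zb; apply/negP => /andP[/= z1 z2].
  have /negP := spB z; apply; apply/and4P; split; apply/exists_inP.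
  - by exists a.
  - by exists b.
  - by exists s.
  - by exists p.
have emp : empty_pair x y e.
  rewrite /empty_pair ysp /=; apply/forallP => z; apply/implyP => zs.
  apply/negP => /orP[|] /andP[h1 h2].
    by have := inside z _ _ sB pB h1 h2; rewrite zs.
  by have := inside z _ _ pB sB h1 h2; rewrite zs.
(* A nearer point [t] would lie horizontally between [q] and [s], contradicting [inside]. *)
have nearl q : q \in B -> beside x y e q -> nearest x y e q.
  move=> qB qb; rewrite /nearest qb; apply/forallP => t; apply/implyP.
  case/and3P => ts t1 t2; rewrite leNgt; apply/negP => qt.
  by have := inside t _ _ qB sB qt t1; rewrite ts.
have nearr q : q \in B -> beside (\- x) y e q -> nearest (\- x) y e q.
  move=> qB qb; rewrite /nearest qb; apply/forallP => t; apply/implyP.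
  case/and3P => ts /=; rewrite !ltrN2 lerN2 => t1 t2.
  rewrite leNgt; apply/negP => qt.
  by have := inside t _ _ sB qB t1 qt; rewrite ts.
exists e, [exists q in B, beside x y e q], [exists q in B, beside (\- x) y e q].
split=> //.
- by apply/implyP => /exists_inP[q _ qb]; apply/existsP; exists q.
- by apply/implyP => /exists_inP[q _ qb]; apply/existsP; exists q.
apply/finset.setP => z; rewrite mem_hull; apply/idP/idP => [zB|].
  have [-> //|zs] := eqVneq z s; have [-> //|zp] := eqVneq z p; rewrite /=.
  have zst : strip y e z.
    have := s_min _ zB; have := p_max _ zB; rewrite /strip /=.
    by case: (inj_lt_total _ _ _ y_inj zs); case: (inj_lt_total _ _ _ y_inj zp);
      lra.
  have lb : beside x y e z -> [exists q in B, beside x y e q] &&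
      nearest x y e z.
    by move=> zb; rewrite nearl // andbT; apply/exists_inP; exists z.
  have rb : beside (\- x) y e z -> [exists q in B, beside (\- x) y e q] &&
      nearest (\- x) y e z.
    by move=> zb; rewrite nearr // andbT; apply/exists_inP; exists z.
  have /andP[_ /forallP/(_ z)] := emp; rewrite zst /=.
  case: (inj_lt_total _ _ _ x_inj zs) => h1;
    case: (inj_lt_total _ _ _ x_inj zp) => h2; rewrite ?h1 ?h2 ?orbT // => _.
    by rewrite lb // /beside zst h1.
  by rewrite rb ?orbT // /beside zst /= !ltrN2 h1.
(* For the converse inclusion, the adjoined point equals the element of [B] that makes its flag
   true. *)
have uniq f q : injective f -> nearest f y e q -> nearest f y e z -> z = q.
  move=> f_inj /andP[qb /forallP q_max] /andP[zb /forallP z_max].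
  apply: f_inj; apply/eqP.
  by rewrite eq_le (implyP (q_max z) zb) (implyP (z_max q) qb).
case/or4P=> [/eqP-> //|/eqP-> //||].
  by case/andP=> /exists_inP[q qB /(nearl _ qB) qn] /(uniq _ _ x_inj qn) ->.
have Nx_inj : injective (\- x) by move=> a b /= /oppr_inj /x_inj.
by case/andP=> /exists_inP[q qB /(nearr _ qB) qn] /(uniq _ _ Nx_inj qn) ->.
Qed.

Lemma card_spans2 x y : injective x -> injective y ->
  #|[set B : {set T} | (#|B| == 2%N) && spans x y B]| = #|[set e | empty_pair x y e]|.
Proof.
move=> x_inj y_inj.
rewrite -(@card_in_imset _ _ (hull x y false false)); last first.
  by move=> e e'; rewrite !inE; exact: hull_inj.
apply: eq_card => B; rewrite inE; apply/andP/imsetP => [[/eqP B2 spB]|].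
  have [|e [bl [br [emp hl hr BE]]]] := spans_hullP _ _ _ x_inj y_inj _ spB.
    by rewrite B2.
  exists e; first by rewrite inE.
  move: B2; rewrite BE card_hull // {BE}.
  by case: bl hl => hl; case: br hr => hr.
case=> e; rewrite inE => emp ->.
by rewrite spans_hull // card_hull.
Qed.

(** By [card_hull], size 3 means that exactly one flag is set, which gives one family per side. *)
Lemma card_spans3 x y : injective x -> injective y ->
  #|[set B : {set T} | (#|B| == 3%N) && spans x y B]| =
  (#|[set e | empty_pair x y e && extends x y e]| +
   #|[set e | empty_pair x y e && extends (\- x) y e]|)%N.
Proof.
move=> x_inj y_inj.
rewrite -(@card_in_imset _ _ (hull x y true false)); last first.
  move=> e e'; rewrite !inE => /andP[h _] /andP[h' _]; exact: hull_inj.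
rewrite -(@card_in_imset _ _ (hull x y false true)); last first.
  move=> e e'; rewrite !inE => /andP[h _] /andP[h' _]; exact: hull_inj.
(* A common hull would come from a single pair, but its nearest western point is not in the eastern
   hull. *)
rewrite -cardsUI [X in _ = (_ + X)%N](_ : _ = 0%N) ?addn0; last first.
  apply/eqP; rewrite cards_eq0; apply/eqP/finset.setP => B; rewrite !inE.
  apply/negP => /andP[/imsetP[e]]; rewrite inE => /andP[emp ext] ->.
  case/imsetP=> e'; rewrite inE => /andP[emp' ext'] eqH.
  have ee' := hull_inj _ _ _ _ _ _ _ _ y_inj emp emp' eqH; subst e'.
  have [q qb qE] := nearest_set _ _ _ x_inj ext.
  have qn : nearest x y e q by have := finset.set11 q; rewrite -qE inE.
  have := mem_hull x y true false e q; rewrite eqH mem_hull qn.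
  have [/negPf-> /negPf->] := beside_neq _ _ _ _ qb => /=.
  rewrite /nearest; have -> : beside (\- x) y e q = false => //.
  apply/negP => /and3P[_ /= + _]; case/and3P: qb => _ qe _.
  by rewrite ltrN2 ltNge (ltW qe).
apply: eq_card => B; rewrite !inE; apply/andP/orP => [[/eqP B3 spB]|].
  have [|e [bl [br [emp hl hr BE]]]] := spans_hullP _ _ _ x_inj y_inj _ spB.
    by rewrite B3.
  move: B3; rewrite BE card_hull // {BE}.
  case: bl hl => hl; case: br hr => hr // _.
    by left; apply/imsetP; exists e; rewrite // inE emp.
  by right; apply/imsetP; exists e; rewrite // inE emp.
by case=> /imsetP[e]; rewrite inE => /andP[emp ext] ->;
  rewrite spans_hull // card_hull // ext.
Qed.

Lemma card_spans4 x y : injective x -> injective y ->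
  #|[set B : {set T} | (#|B| == 4%N) && spans x y B]| =
  #|[set e | [&& empty_pair x y e, extends x y e & extends (\- x) y e]]|.
Proof.
move=> x_inj y_inj.
rewrite -(@card_in_imset _ _ (hull x y true true)); last first.
  by move=> e e'; rewrite !inE => /and3P[h _ _] /and3P[h' _ _]; exact: hull_inj.
apply: eq_card => B; rewrite inE; apply/andP/imsetP => [[/eqP B4 spB]|].
  have [|e [bl [br [emp hl hr BE]]]] := spans_hullP _ _ _ x_inj y_inj _ spB.
    by rewrite B4.
  move: B4; rewrite BE card_hull // {BE}.
  case: bl hl => hl; case: br hr => hr // _.
  by exists e; rewrite // inE emp; move: hl hr => /= -> ->.
case=> e; rewrite inE => /and3P[emp h1 h2] ->.
by rewrite spans_hull // card_hull // ?h1 ?h2.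
Qed.

(** * Empty quadrants and exposed points *)

(** Only the highest point has both northern quadrants empty. Reflections and exchanging the
    coordinates give the other three sides of the bounding box. *)
Lemma card_halfplane x y (t0 : T) : injective x -> injective y ->
  #|[set p | ~~ inhab x y p && ~~ inhab (\- x) y p]| = 1%N.
Proof.
move=> x_inj y_inj; rewrite -(card_max y t0 y_inj); apply: eq_card => p.
rewrite !inE; apply/andP/forallP => [[/existsPn nw /existsPn ne] z|p_max].
  rewrite leNgt; apply/negP => yz; have := nw z; have := ne z.
  have zp : z != p by apply/negP => /eqP zE; move: yz; rewrite zE ltxx.
  by rewrite /quad /= yz !andbT ltrN2; case: (inj_lt_total _ _ _ x_inj zp) => ->.
by split; apply/existsPn => z; rewrite /quad negb_and -[X in _ || X]leNgt p_max orbT.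
Qed.

Lemma inhab_opp x y p : inhab y x p = inhab (\- x) (\- y) p.
Proof. by apply: eq_existsb => z; rewrite /quad /= !ltrN2 andbC. Qed.

Lemma inhab_oppl x y p : inhab (\- y) x p = inhab (\- x) y p.
Proof. by apply: eq_existsb => z; rewrite /quad /= !ltrN2 andbC. Qed.

Lemma inhab_oppr x y p : inhab y (\- x) p = inhab x (\- y) p.
Proof. by apply: eq_existsb => z; rewrite /quad /= !ltrN2 andbC. Qed.

Definition exposed_at x y p :=
  [|| ~~ inhab (\- x) y p, ~~ inhab x y p,
      ~~ inhab x (\- y) p | ~~ inhab (\- x) (\- y) p].

Definition pinched_at x y p :=
  [&& ~~ inhab (\- x) y p, ~~ inhab x (\- y) p,
      inhab x y p & inhab (\- x) (\- y) p]
  || [&& ~~ inhab x y p, ~~ inhab (\- x) (\- y) p,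
      inhab (\- x) y p & inhab x (\- y) p].

(** Rules out four empty quadrants, where exposed + pinched + extremal would be 1 + 0 + 4 instead of
    4. *)
Lemma some_inhab x y p : injective x -> injective y -> (1 < #|T|)%N ->
  [|| inhab (\- x) y p, inhab x y p,
      inhab x (\- y) p | inhab (\- x) (\- y) p].
Proof.
move=> x_inj y_inj /card_gt1P[a [b [_ _ ab]]].
have [q qp] : exists q, q != p.
  by case: (eqVneq a p) ab => [->|]; [exists b; rewrite eq_sym|exists a].
case: (inj_lt_total _ _ _ x_inj qp) => qx;
  case: (inj_lt_total _ _ _ y_inj qp) => qy; apply/or4P.
- by apply: Or43; apply/existsP; exists q; rewrite /quad /= ltrN2 qx.
- by apply: Or42; apply/existsP; exists q; rewrite /quad /= qx.
- by apply: Or44; apply/existsP; exists q; rewrite /quad /= !ltrN2 qx.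
- by apply: Or41; apply/existsP; exists q; rewrite /quad /= ltrN2 qx.
Qed.

(* A point with [j] empty quadrants, where [j <= 3] as there are two points,
   contributes [j] to exposed + pinched + extremal, where extremal counts the
   sides of the bounding box of all points on which it lies; these sides give
   the constant [4]. *)
Lemma card_exposed x y : injective x -> injective y -> (1 < #|T|)%N ->
  (#|[set p | exposed_at x y p]| + #|[set p | pinched_at x y p]| + 4 +
   (#|[set p | inhab x y p]| + #|[set p | inhab x (\- y) p]| +
    #|[set p | inhab (\- x) y p]| + #|[set p | inhab (\- x) (\- y) p]|)
   = 4 * #|T|)%N.
Proof.
move=> x_inj y_inj T_gt1.
have [t0 _] : exists t0 : T, t0 \in T.
  by apply/card_gt0P; exact: ltnW.
have Nx_inj : injective (\- x) by move=> a b /= /oppr_inj /x_inj.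
have Ny_inj : injective (\- y) by move=> a b /= /oppr_inj /y_inj.
have sumE (P : pred T) : #|[set p | P p]| = (\sum_p P p)%N.
  by rewrite -sum1dep_card big_mkcond /=; apply: eq_bigr => p _; case: (P p).
have top := card_halfplane x y t0 x_inj y_inj.
have bot := card_halfplane x (\- y) t0 x_inj Ny_inj.
have rgt := card_halfplane y x t0 y_inj x_inj.
have lft := card_halfplane y (\- x) t0 y_inj Nx_inj.
(* Each 1 becomes the number of points on one side of the bounding box, so that the identity can be
   checked point by point. *)
rewrite -[4%N in LHS]/(1 + 1 + 1 + 1)%N -{1}top -{1}bot -{1}rgt -{1}lft.
rewrite !sumE -!big_split /= mulnC -sum_nat_const.
apply: eq_bigr => p _.
rewrite (inhab_opp x y) (inhab_oppl x y) (inhab_oppr x y).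
have -> : inhab (\- y) (\- x) p = inhab x y p.
  by apply: eq_existsb => z; rewrite /quad /= !ltrN2 andbC.
have := some_inhab x y p x_inj y_inj T_gt1.
rewrite /exposed_at /pinched_at.
by case: (inhab (\- x) y p); case: (inhab x y p); case: (inhab x (\- y) p);
   case: (inhab (\- x) (\- y) p).
Qed.

(** * Combination of the counts *)

Lemma card_setI_not (E P : pred T) :
  #|[set e | E e]| = (#|[set e | E e && P e]| + #|[set e | E e && ~~ P e]|)%N.
Proof.
rewrite -(cardsID [set e | P e] [set e | E e]); congr (_ + _)%N.
  by apply: eq_card => e; rewrite !inE.
by apply: eq_card => e; rewrite !inE andbC.
Qed.

End Counting.

Lemma plane_counts {R : realFieldType} {T : finType} (x y : T -> R) :
  injective x -> injective y -> (1 < #|T|)%N ->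
  let span k := #|[set B : {set T} | (#|B| == k) && spans x y B]| in
  let exp := (#|[set p | exposed_at x y p]| + #|[set p | pinched_at x y p]|)%N in
  (span 2 + exp + 3 = 3 * #|T| + span 4 /\
   2 * span 2 + exp + 4 = 4 * #|T| + span 3)%N.
Proof.
move=> x_inj y_inj T_gt1 span exp; rewrite /span /exp {span exp}.
have Nx_inj : injective (\- x) by move=> a b /= /oppr_inj /x_inj.
have Q := card_exposed x y x_inj y_inj T_gt1.
rewrite card_spans2 // card_spans3 // card_spans4 //.
have L := card_empty_unextended x y x_inj y_inj.
have Rr := card_empty_unextended (\- x) y Nx_inj y_inj.
have LR := card_empty_consecutive x y x_inj y_inj.
pose E := empty_pair x y; pose l := extends x y; pose r := extends (\- x) y.
have H1 := card_setI_not E l.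
have H2 := card_setI_not E r.
have H3 := card_setI_not (fun e => E e && l e) r.
have H4 := card_setI_not (fun e => E e && ~~ r e) l.
have A1 : #|[set e | (E e && l e) && r e]| = #|[set e | [&& E e, l e & r e]]|.
  by apply: eq_card => e; rewrite !inE andbA.
have A2 : #|[set e | (E e && l e) && ~~ r e]| =
    #|[set e | (E e && ~~ r e) && l e]|.
  by apply: eq_card => e; rewrite !inE andbAC.
have A3 : #|[set e | (E e && ~~ r e) && ~~ l e]| =
    #|[set e | [&& E e, ~~ l e & ~~ r e]]|.
  by apply: eq_card => e; rewrite !inE andbAC -andbA.
have A4 : #|[set e | empty_pair (\- x) y e && ~~ extends (\- x) y e]| =
    #|[set e | E e && ~~ r e]|.
  by apply: eq_card => e; rewrite !inE empty_pairN.
rewrite /E /l /r in H1 H2 H3 H4 A1 A2 A3 A4.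
(* Let [q] be the number of nonempty quadrants. Adding [L] and [Rr] gives 2 span_2 - span_3 = [q];
   inclusion-exclusion with [LR] gives span_2 - span_4 = [q] - ([#|T|] - 1); and [Q] says that
   exposed + pinched = 4 ([#|T|] - 1) - [q]. *)
lia.
Qed.

(** * Transfer from the plane to the finite type of points of [X] *)

Section Geometry.
Context {R : realType}.
Implicit Types (X A : {fset R * R}) (z : R * R).

Lemma mem_head_fset A : A != fset0 -> head 0 (enum_fset A) \in A.
Proof.
case/fset0Pn=> a; change (a \in enum_fset A -> head 0 A \in enum_fset A).
by case: (enum_fset A) => //= b s _; rewrite mem_head.
Qed.

Lemma fmin_lt (f : R * R -> R) A v : A != fset0 ->
  (fmin f A < v) <-> (exists2 a, a \in A & f a < v).
Proof.
move=> A0; split; last first.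
  by case=> a aA av; apply: le_lt_trans av; exact: ge_bigmin_seq.
move=> Av; apply: contrapT => h; move: Av; apply/negP; rewrite -leNgt.
have hA a : a \in A -> v <= f a.
  by move=> aA; rewrite leNgt; apply/negP => av; apply: h; exists a.
rewrite /fmin big_seq; apply: le_bigmin => [|a]; apply: hA => //.
exact: mem_head_fset.
Qed.

Lemma lt_fmax (f : R * R -> R) A v : A != fset0 ->
  (v < fmax f A) <-> (exists2 a, a \in A & v < f a).
Proof.
move=> A0; split; last first.
  by case=> a aA av; apply: lt_le_trans av _; exact: le_bigmax_seq.
move=> Av; apply: contrapT => h; move: Av; apply/negP; rewrite -leNgt.
have hA a : a \in A -> f a <= v.
  by move=> aA; rewrite leNgt; apply/negP => av; apply: h; exists a.
rewrite /fmax big_seq; apply: bigmax_le => [|a]; apply: hA => //.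
exact: mem_head_fset.
Qed.

Lemma interior_rectangle A z : interior (rectangle A) z <->
  (fmin fst A < z.1 < fmax fst A /\ fmin snd A < z.2 < fmax snd A).
Proof.
split=> [|[z1 z2]].
  rewrite /interior => /nbhs_ballP[e /= e0 sub].
  (* Diagonal shifts by [e / 2] in both directions stay in the ball and make all four inequalities
     strict. *)
  have Hp := sub (z.1 + e / 2, z.2 + e / 2).
  have Hm := sub (z.1 - e / 2, z.2 - e / 2).
  have [|/= p1 p2] := Hp.
    by split; rewrite /ball /= opprD addrA subrr sub0r normrN gtr0_norm; lra.
  have [|/= m1 m2] := Hm.
    by split; rewrite /ball /= opprB addrCA subrr addr0 gtr0_norm; lra.
  split; lra.
exists (`]fmin fst A, fmax fst A[%classic, `]fmin snd A, fmax snd A[%classic).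
  by split; apply: near_in_itvoo; rewrite in_itv.
case=> a b /= [] /=; rewrite !in_itv /= => /andP[a1 a2] /andP[b1 b2].
by split=> /=; lra.
Qed.

Lemma card_fset_sub X (P : pred (R * R)) :
  #|` [fset p in X | P p]| = #|[set p : X | P (val p)]|.
Proof.
rewrite -(@card_fsub _ X); last by apply/fsubsetP => p; rewrite !inE => /andP[].
apply: eq_card => p; rewrite !inE /=.
by have := valP p; rewrite /= => ->.
Qed.

Lemma boundary_rectangle A a : a \in A ->
  ~ interior (rectangle A) a -> boundary (rectangle A) a.
Proof.
move=> aA nint; split=> //; apply: subset_closure.
by split; apply/andP; split; first [exact: ge_bigmin_seq | exact: le_bigmax_seq].
Qed.

Variable X : {fset R * R}.

Definition xcoord (p : X) : R := (val p).1.
Definition ycoord (p : X) : R := (val p).2.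

Lemma xcoord_inj : generic X -> injective xcoord.
Proof.
move=> hX p q pq; apply: val_inj; apply/eqP/negPn/negP => npq.
by have [/eqP] := hX _ _ (valP p) (valP q) npq.
Qed.

Lemma ycoord_inj : generic X -> injective ycoord.
Proof.
move=> hX p q pq; apply: val_inj; apply/eqP/negPn/negP => npq.
by have [_ /eqP] := hX _ _ (valP p) (valP q) npq.
Qed.

Lemma spanningE (B : {set X}) : B != finset.set0 ->
  `[< spanning X [fset val p | p in B] >] = spans xcoord ycoord B.
Proof.
move=> /finset.set0Pn[b0 b0B]; set A := [fset val p | p in B]%fset.
have A0 : A != fset0 by apply/fset0Pn; exists (val b0); rewrite in_imfset.
have exA (P : pred (R * R)) :
    (exists2 a, a \in A & P a) <-> [exists a in B, P (val a)].
  split=> [[_ /imfsetP[a /= aB ->] Pa]|/exists_inP[a aB Pa]].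
    by apply/exists_inP; exists a.
  by exists (val a); rewrite ?in_imfset.
have intE z : interior (rectangle A) z <->
    [&& [exists a in B, xcoord a < z.1], [exists a in B, z.1 < xcoord a],
        [exists a in B, ycoord a < z.2] & [exists a in B, z.2 < ycoord a]].
  rewrite interior_rectangle; split.
    move=> [/andP[/(fmin_lt _ _ _ A0)/exA h1 /(lt_fmax _ _ _ A0)/exA h2]].
    move=> /andP[/(fmin_lt _ _ _ A0)/exA h3 /(lt_fmax _ _ _ A0)/exA h4].
    exact/and4P.
  case/and4P=> h1 h2 h3 h4; split; apply/andP; split.
  - exact/(fmin_lt _ _ _ A0)/(exA (fun a => a.1 < z.1)).
  - exact/(lt_fmax _ _ _ A0)/(exA (fun a => z.1 < a.1)).
  - exact/(fmin_lt _ _ _ A0)/(exA (fun a => a.2 < z.2)).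
  - exact/(lt_fmax _ _ _ A0)/(exA (fun a => z.2 < a.2)).
apply/asboolP/forallP => [[h _] z|h].
  by apply/negP => /intE; apply: h; exact: valP.
(* Elements of [A] lie in [X], so the empty interior puts them on the boundary. *)
have nint z : z \in X -> ~ interior (rectangle A) z.
  by move=> zX /intE; apply/negP; exact: h [` zX].
split=> // a aA; apply: boundary_rectangle => //; apply: nint.
by case/imfsetP: aA => p _ ->; exact: valP.
Qed.

(** Subsets of [X] are the injective images of sets over the type [X]; [0 < k] makes them nonempty,
    as [spanningE] requires. *)
Lemma span_numE k : (0 < k)%N ->
  span_num k X = #|[set B : {set X} | (#|B| == k) && spans xcoord ycoord B]|.
Proof.
move=> k0; rewrite /span_num.
have img_inj : injective (fun B : {set X} => [fset val p | p in B]%fset).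
  move=> B C BC; apply/finset.setP => p.
  have memE (D : {set X}) : (p \in D) = (val p \in [fset val q | q in D]%fset).
    by apply/idP/imfsetP => [pD|[q qD /val_inj->] //]; exists p.
  by rewrite !memE BC.
rewrite cardE -(size_map (fun B : {set X} => [fset val p | p in B]%fset)).
have card_img (B : {set X}) : #|` [fset val p | p in B]%fset| = #|B|.
  by rewrite card_imfset /=; [rewrite cardE|exact: val_inj].
apply: perm_size; apply: uniq_perm; first exact: fset_uniq.
  by rewrite map_inj_uniq ?enum_uniq.
move=> A; rewrite -[A \in enum_fset _]/(A \in [fset _ in _ | _]%fset).
rewrite !inE /=; apply/andP/mapP => [[/imfsetP[B _ ->]]|[B]].
  rewrite card_img => /andP[/eqP Bk sp]; exists B => //.
  rewrite mem_enum inE Bk eqxx -spanningE //.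
  by rewrite -cards_eq0 Bk -lt0n.
rewrite mem_enum inE => /andP[/eqP Bk sp] ->; split.
  by apply/imfsetP; exists B; rewrite //= powersetE finset.subsetT.
by rewrite card_img Bk eqxx spanningE // -cards_eq0 Bk -lt0n.
Qed.

Lemma avoidsE (Q : set (R * R)) (P : pred X) :
  (forall z : X, Q (val z) <-> P z) -> avoids X Q <-> ~~ [exists z, P z].
Proof.
move=> QP; split=> [h|/existsPn h z zX Qz].
  by apply/existsPn => z; apply/negP => /QP; apply: h; exact: valP.
by move: (h [` zX]) => /negP; apply; apply/QP.
Qed.

Lemma avoids_quadrants (p : X) :
  [/\ avoids X (quadrantNE (val p)) <-> ~~ inhab (\- xcoord) ycoord p,
      avoids X (quadrantNW (val p)) <-> ~~ inhab xcoord ycoord p,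
      avoids X (quadrantSW (val p)) <-> ~~ inhab xcoord (\- ycoord) p &
      avoids X (quadrantSE (val p)) <-> ~~ inhab (\- xcoord) (\- ycoord) p].
Proof.
by split; apply: avoidsE => z; rewrite /quad /= ?ltrN2; split=> [[? ?]|/andP[]//];
   apply/andP.
Qed.

Lemma exposedE : exposed X = #|[set p | exposed_at xcoord ycoord p]|.
Proof.
rewrite /exposed card_fset_sub; apply: eq_card => p; rewrite !inE.
have [ne nw sw se] := avoids_quadrants p.
by apply/asboolP/or4P => -[] => [/ne|/nw|/sw|/se|/ne|/nw|/sw|/se] h;
  [exact: Or41|exact: Or42|exact: Or43|exact: Or44
  |exact: Or41|exact: Or42|exact: Or43|exact: Or44].
Qed.

Lemma npinchedE : npinched X = #|[set p | pinched_at xcoord ycoord p]|.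
Proof.
rewrite /npinched card_fset_sub; apply: eq_card => p; rewrite !inE.
have [ne nw sw se] := avoids_quadrants p.
rewrite /pinched_at; apply/asboolP/idP; rewrite /pinched ne nw sw se.
  by case=> -[-> [-> [/negP/negPn -> /negP/negPn ->]]]; rewrite ?orbT.
by case/orP => /and4P[-> -> -> ->]; [left|right].
Qed.

End Geometry.

Theorem theorem2 (R : realType) (X : {fset R * R}) (hX : generic X)
    (hX2 : (2 <= #|` X|)%N) :
  (span_num 2 X)%:Z - (span_num 4 X)%:Z + ((exposed X)%:Z + (npinched X)%:Z)
    = 3 * ((#|` X|)%:Z - 1) /\
  2 * (span_num 2 X)%:Z - (span_num 3 X)%:Z + ((exposed X)%:Z + (npinched X)%:Z)
    = 4 * ((#|` X|)%:Z - 1).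
Proof.
rewrite !span_numE // exposedE npinchedE.
rewrite cardfE in hX2 *.
have [H1 H2] := plane_counts (xcoord X) (ycoord X) (xcoord_inj X hX)
  (ycoord_inj X hX) hX2.
have arith (s2 s3 s4 ex pi n : nat) :
    (s2 + (ex + pi) + 3 = 3 * n + s4)%N ->
    (2 * s2 + (ex + pi) + 4 = 4 * n + s3)%N ->
    s2%:Z - s4%:Z + (ex%:Z + pi%:Z) = 3 * (n%:Z - 1) /\
    2 * s2%:Z - s3%:Z + (ex%:Z + pi%:Z) = 4 * (n%:Z - 1).
  by lia.
exact: arith H1 H2.
Qed.
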